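(* Let $\xi\in\mathbb{R}$ be such that $1,\xi,\xi^3$ are linearly independent over $\mathbb{Q}$, let $\lambda,c>0$ be such that for each sufficiently large real number $X$ there exists a non-zero point $\mathbf{x}\in\mathbb{Z}^3$ with $\|\mathbf{x}\|\le X$ and $L(\mathbf{x})\le cX^{-\lambda}$, and let $(\mathbf{x}_i)_{i\ge1}$ be a sequence of minimal points for $(1,\xi,\xi^3)$. Suppose that $\lambda\ge 0.6985$. Then $F_i^3+27S_i^4V_i^2\ne0$ for any large enough $i\in I$.
   Context: For $\mathbf{x}=(x_0,x_1,x_2)\in\mathbb{R}^3$, put $\|\mathbf{x}\|=\max\{|x_0|,|x_1|,|x_2|\}$ and $L(\mathbf{x})=\max\{|x_1-x_0\xi|,|x_2-x_0\xi^3|\}$. A sequence of minimal points for $(1,\xi,\xi^3)$ is a sequence $(\mathbf{x}_i)_{i\ge1}$ of non-zero points of $\mathbb{Z}^3$ such that, with $X_i=\|\mathbf{x}_i\|$ and $L_i=L(\mathbf{x}_i)$: (a) $X_1<X_2<X_3<\cdots$; (b) $1/2>L_1>L_2>L_3>\cdots$; (c) if $L(\mathbf{x})<L_i$ for some $\mathbf{x}\in\mathbb{Z}^3\setminus\{0\}$ and some $i\ge1$, then $\|\mathbf{x}\|\ge X_{i+1}$. $I$ is the set of integers $i\ge2$ such that $\mathbf{x}_{i-1},\mathbf{x}_i,\mathbf{x}_{i+1}$ are linearly independent; it is an infinite set, ordered increasingly. Put $$\varphi(\mathbf{x})=x_0^2x_2-x_1^3,\qquad \Phi(\mathbf{x},\mathbf{y},\mathbf{z})=x_0y_0z_2+x_0y_2z_0+x_2y_0z_0-3x_1y_1z_1,$$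 $$F(\mathbf{x},\mathbf{y})=\Phi(\mathbf{x},\mathbf{x},\mathbf{y})^2-4\varphi(\mathbf{x})\Phi(\mathbf{x},\mathbf{y},\mathbf{y}).$$ For $i\in I$ with successor $j$ in $I$: $S_i=\varphi(\mathbf{x}_i)$, $V_i=\varphi(\mathbf{x}_j)$, $F_i=F(\mathbf{x}_i,\mathbf{x}_j)$. *)

(* Defs.v *)
From HB Require Import structures.
From mathcomp Require Import all_boot all_order all_algebra.
From mathcomp Require Import all_classical all_reals all_analysis.

Set Implicit Arguments.
Unset Strict Implicit.
Unset Printing Implicit Defensive.

Import Order.TTheory GRing.Theory Num.Theory.

Local Open Scope ring_scope.

Definition norm3 (R : realType) (x : 'rV[R]_3) : R :=
  Num.max (Num.max `|x 0 0| `|x 0 1|) `|x 0 2|.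

Definition Ldist (R : realType) (xi : R) (x : 'rV[R]_3) : R :=
  Num.max `|x 0 1 - x 0 0 * xi| `|x 0 2 - x 0 0 * xi ^+ 3|.

Definition embZ (R : realType) (x : 'rV[int]_3) : 'rV[R]_3 :=
  map_mx (intr : int -> R) x.

Definition lin_indep_1_xi_xi3 (R : realType) (xi : R) : Prop :=
  forall a b c : rat,
    ratr a + ratr b * xi + ratr c * xi ^+ 3 = 0 -> [/\ a = 0, b = 0 & c = 0].

(* The sequences of points are indexed from 1: the value at 0 is junk and is
   not constrained. *)
Definition minimal_points (R : realType) (xi : R) (x : nat -> 'rV[int]_3)
    : Prop :=
  let X i := norm3 (embZ R (x i)) in
  let L i := Ldist xi (embZ R (x i)) in
  [/\ forall i : nat, (1 <= i)%N -> x i <> 0,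
      forall i : nat, (1 <= i)%N -> X i < X i.+1,
      L 1%N < 2^-1 /\ (forall i : nat, (1 <= i)%N -> L i.+1 < L i)
    & forall (i : nat) (y : 'rV[int]_3), (1 <= i)%N -> y <> 0 ->
        Ldist xi (embZ R y) < L i -> X i.+1 <= norm3 (embZ R y)].

Definition indexI (R : realType) (x : nat -> 'rV[int]_3) (i : nat) : Prop :=
  (2 <= i)%N /\ free [:: embZ R (x i.-1); embZ R (x i); embZ R (x i.+1)].

Definition succI (R : realType) (x : nat -> 'rV[int]_3) (i j : nat) : Prop :=
  [/\ indexI R x i, indexI R x j, (i < j)%N
    & forall k : nat, (i < k)%N -> (k < j)%N -> ~ indexI R x k].

Definition phi (A : comPzRingType) (x : 'rV[A]_3) : A :=
  x 0 0 ^+ 2 * x 0 2 - x 0 1 ^+ 3.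

Definition Phi (A : comPzRingType) (x y z : 'rV[A]_3) : A :=
  x 0 0 * y 0 0 * z 0 2 + x 0 0 * y 0 2 * z 0 0 + x 0 2 * y 0 0 * z 0 0
  - 3 * x 0 1 * y 0 1 * z 0 1.

Definition Fpol (A : comPzRingType) (x y : 'rV[A]_3) : A :=
  Phi x x y ^+ 2 - 4 * phi x * Phi x y y.

(* Main.v *)
Require Import Defs.
From HB Require Import structures.
From mathcomp Require Import all_boot all_order all_algebra.
From mathcomp Require Import all_classical all_reals all_analysis.
From mathcomp Require Import ring lra.

Import Order.TTheory GRing.Theory Num.Theory.
Import numFieldNormedType.Exports.

Local Open Scope classical_set_scope.
Local Open Scope ring_scope.

(** Write S = phi x_i, V = phi x_j, T = Phi x_i x_i x_j, U = Phi x_i x_j x_j,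
    so that F = T^2 - 4 S U, and let X_k, L_k be the norm of x_k and its
    distance to the line spanned by (1, xi, xi^3).  The exponent lambda only
    matters through L_k << X_(k+1)^(-30/43), as 30/43 < 0.6985.

    Suppose F^3 = - 27 S^4 V^2.  As 30/43 > 2/3, neither S nor V vanishes when
    i is large ([minimal_phi_neq0]).  Hence F = - 3 r^2 and S^2 V = r^3 for some
    nonzero integer r ([sextic_zero_param]), and two facts are in conflict.

    - Arithmetic.  Let n be the gcd of the coordinates of the cross product of
      x_i and x_j.  Then n^3 divides 108 (T - 3 r) r^2 ([index_cube_dvd]), and
      T <> 3 r, because T = 3 r would make the cuspidal cubic phi = 0 meet the
      line through x_i and x_j with multiplicity three at a single point
      ([not_triple_contact]).  As x_i, x_(i+1) and x_j are coplanar,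
      n >> X_j / X_(i+1) ([index_lower]).

    - Size.  The definition of F makes its terms of order X_j^2 X_i^2 L_i^2 and
      X_j^2 X_i L_i^3 cancel, leaving
      F << X_j^2 L_i^4 + X_i^3 X_j L_i L_j ([Fpol_bound]).  The second term
      tends to 0, while |F| = 3 r^2 >= 3, so that r << X_j L_i^2; moreover
      T << X_i X_j L_i.

    Together they give X_j^3 / X_(i+1)^3 << X_i X_j^3 L_i^5, that is,
    1 << X_i X_(i+1)^3 L_i^5 ([sextic_zero_bound]).  For an element i of I the
    nonzero determinant of x_(i-1), x_i, x_(i+1) yields X_(i+1) >> X_i^(30/13),
    and with L_i << X_(i+1)^(-30/43) the right-hand side tends to 0.  All
    comparisons of exponents become linear after taking logarithms
    ([exponent_inequalities]). *)

(** * Integers *)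

Lemma eq_cube_sqr_int (a b : int) :
  a ^+ 3 = b ^+ 2 -> exists r, a = r ^+ 2 /\ b = r ^+ 3.
Proof.
move=> ab; have [a0|a0] := eqVneq a 0.
  exists 0; move: ab; rewrite a0 expr0n /= => /esym/eqP.
  by rewrite expf_eq0 /= => /eqP ->; rewrite !expr0n.
have : (a ^+ 2 %| b ^+ 2)%Z by rewrite -ab exprS dvdz_mull.
rewrite dvdzE !abszX dvdn_pexp2r // -dvdzE => /dvdzP[r br].
have ar : a = r ^+ 2.
  apply: (mulIf (expf_neq0 2 a0)); rewrite -exprS ab br; ring.
by exists r; split => //; rewrite br ar; ring.
Qed.

Lemma dvd3_of_cube (f m : int) : f ^+ 3 = 27 * m -> (3 %| f)%Z.
Proof.
move=> fm; have : ((3 : int) ^+ 3 %| f ^+ 3)%Z by rewrite fm dvdz_mulr.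
by rewrite !dvdzE !abszX dvdn_pexp2r.
Qed.

(** The equation says that 27 (S^2 V)^2 is the cube of - F, so - F is three
    times a square and S^2 V is the cube of its root. *)
Lemma sextic_zero_param (F S V : int) : S != 0 -> V != 0 ->
  F ^+ 3 + 27 * S ^+ 4 * V ^+ 2 = 0 ->
  exists r, [/\ r != 0, F = - 3 * r ^+ 2 & r ^+ 3 = S ^+ 2 * V].
Proof.
move=> S0 V0 FSV.
have F3 : F ^+ 3 = 27 * - (S ^+ 4 * V ^+ 2).
  by apply/eqP; rewrite -subr_eq0 -FSV; apply/eqP; ring.
have /dvdzP[g Fg] := dvd3_of_cube _ _ F3.
have /eq_cube_sqr_int[r [gr SVr]] : (- g) ^+ 3 = (S ^+ 2 * V) ^+ 2.
  apply: (@mulfI _ (27 : int)) => //; move: F3; rewrite Fg => F3.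
  transitivity (- (g * 3) ^+ 3); first by ring.
  by rewrite F3; ring.
exists r; split => //; last by rewrite Fg -[g]opprK gr; ring.
apply/eqP => r0; move: SVr; rewrite r0 expr0n /= => /eqP.
by rewrite mulf_eq0 expf_eq0 (negPf S0) (negPf V0).
Qed.

Lemma int_lowest_terms (c d : int) : c != 0 ->
  exists g a b : int, [/\ g != 0, coprimez a b, c = a * g & d = b * g].
Proof.
move=> c0; have g0 : gcdz c d != 0 by rewrite gcdz_eq0 (negPf c0).
exists (gcdz c d), (c %/ gcdz c d)%Z, (d %/ gcdz c d)%Z; split => //.
- apply/eqP/(mulIf g0); rewrite mul1r.
  have := mulz_gcdl (c %/ gcdz c d)%Z (d %/ gcdz c d)%Z (gcdz c d).
  by rewrite !divzK ?dvdz_gcdl ?dvdz_gcdr.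
- by rewrite divzK // dvdz_gcdl.
- by rewrite divzK // dvdz_gcdr.
Qed.

(** w / n is a rational root of a monic integral quartic, hence an integer. *)
Lemma dvdz_integral4 (n w a b c d : int) : n != 0 ->
  w ^+ 4 + a * n * w ^+ 3 + b * n ^+ 2 * w ^+ 2 + c * n ^+ 3 * w
    + d * n ^+ 4 = 0 -> (n %| w)%Z.
Proof.
move=> n0 eq0.
have [g [n' [w' [g0 cop ng wg]]]] := int_lowest_terms n w n0.
have {}eq0 : w' ^+ 4 = n' * - (a * w' ^+ 3 + b * n' * w' ^+ 2
    + c * n' ^+ 2 * w' + d * n' ^+ 3).
  apply: (mulIf (expf_neq0 4 g0)); apply/eqP; rewrite -subr_eq0.
  by rewrite -[X in _ == X]eq0 ng wg; apply/eqP; ring.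
have : (n' %| w' ^+ 4)%Z by rewrite eq0 dvdz_mulr.
have cop4 : coprimez n' (w' ^+ 4) by rewrite coprimezXr.
rewrite -[w' ^+ 4]mul1r Gauss_dvdzl // => n1.
by rewrite ng wg dvdz_mul // (dvdz_trans n1).
Qed.

(** T, U, V are the coefficients that Phi and phi take on x and m x + n x',
    where S, T1, U1, V1 are those on x and x'.  With z = r - m S the two
    hypotheses become linear and quadratic in m S; eliminating m S shows that
    3 z / n is a root of a monic integral quartic, hence an integer.  A second
    elimination gives
    4 (T - 3 r) r^2 = - z^3 + n T1 z^2 - n^2 B z + n^3 (T1 B - 8 S^2 V1)
    with B = 4 S U1 - T1^2, and 27 times the right-hand side is then a multiple
    of n^3. *)
Lemma cube_dvd_contact (m n S T1 U1 V1 r : int) : n != 0 ->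
  let T := 3 * m * S + n * T1 in
  let U := 3 * m ^+ 2 * S + 2 * m * n * T1 + n ^+ 2 * U1 in
  let V := m ^+ 3 * S + m ^+ 2 * n * T1 + m * n ^+ 2 * U1 + n ^+ 3 * V1 in
  T ^+ 2 - 4 * S * U = - 3 * r ^+ 2 -> r ^+ 3 = S ^+ 2 * V ->
  (n ^+ 3 %| 108 * (T - 3 * r) * r ^+ 2)%Z.
Proof.
move=> n0 T U V eqF eqr.
pose z := r - m * S; pose M := m * S; pose U' := S * U1.
pose V' := S ^+ 2 * V1; pose B := 4 * U' - T1 ^+ 2; pose h := n * T1 - 3 * z.
have e1 : 2 * M * h - 3 * z ^+ 2 + n ^+ 2 * B = 0.
  transitivity (- (T ^+ 2 - 4 * S * U - (- 3 * r ^+ 2))).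
    by rewrite /h /B /U' /M /z /T /U; ring.
  by rewrite eqF subrr oppr0.
have e2 : - M ^+ 2 * h + M * (3 * z ^+ 2 - n ^+ 2 * U') + z ^+ 3
    - n ^+ 3 * V' = 0.
  transitivity (r ^+ 3 - S ^+ 2 * V); last by rewrite eqr subrr.
  by rewrite /h /U' /V' /M /z /V; ring.
have rM : r = M + z by rewrite /M /z; ring.
(* the combination below eliminates M between e1 and e2 *)
have : (n %| 3 * z)%Z.
  apply: (@dvdz_integral4 n (3 * z) (- 4 * T1) (18 * U') (- 108 * V')
    (27 * (4 * T1 * V' + B * (B - 2 * U')))) => //.
  transitivity (- 27 * (2 * h * (2 * (- M ^+ 2 * h
    + M * (3 * z ^+ 2 - n ^+ 2 * U') + z ^+ 3 - n ^+ 3 * V')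
    + M * (2 * M * h - 3 * z ^+ 2 + n ^+ 2 * B))
    - (3 * z ^+ 2 + n ^+ 2 * (B - 2 * U'))
      * (2 * M * h - 3 * z ^+ 2 + n ^+ 2 * B))); last by rewrite e1 e2; ring.
  by rewrite /h /B; ring.
move=> /dvdzP[w zw].
apply/dvdzP; exists (- w ^+ 3 + 3 * T1 * w ^+ 2 - 9 * B * w
   + 27 * (T1 * B - 8 * V')).
have -> : 108 * (T - 3 * r) * r ^+ 2 = 27 * (4 * h * (M + z) ^+ 2).
  by rewrite -rM /T /h /z; ring.
have -> : 4 * h * (M + z) ^+ 2 = - z ^+ 3 + n * T1 * z ^+ 2
    - n ^+ 2 * B * z + n ^+ 3 * (T1 * B - 8 * V').
  apply/eqP; rewrite -subr_eq0; apply/eqP.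
  transitivity ((- 2 * M - h - 2 * z)
      * (2 * M * h - 3 * z ^+ 2 + n ^+ 2 * B)
    - 8 * (- M ^+ 2 * h + M * (3 * z ^+ 2 - n ^+ 2 * U') + z ^+ 3
           - n ^+ 3 * V')); last by rewrite e1 e2; ring.
  by rewrite /h /B; ring.
transitivity (- (3 * z) ^+ 3 + 3 * n * T1 * (3 * z) ^+ 2
    - 9 * n ^+ 2 * B * (3 * z) + 27 * n ^+ 3 * (T1 * B - 8 * V')).
  by ring.
by rewrite zw; ring.
Qed.

(** * Integral points and the cuspidal cubic *)

(** The coordinates of the cross product of x and y, indexed by pairs so that
    the third index never has to be computed. *)
Definition minor2 {A : comPzRingType} (x y : 'rV[A]_3) (a b : 'I_3) : A :=
  x 0 a * y 0 b - x 0 b * y 0 a.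

Definition det3 {A : comPzRingType} (x y z : 'rV[A]_3) : A :=
  z 0 0 * minor2 x y 1 2 - z 0 1 * minor2 x y 0 2
  + z 0 2 * minor2 x y 0 1.

(** The Bezout form of having coprime coordinates. *)
Definition primitive3 (x : 'rV[int]_3) : Prop :=
  exists u : 'rV[int]_3,
    u 0 0 * x 0 0 + u 0 1 * x 0 1 + u 0 2 * x 0 2 = 1.

Lemma ord3P (P : 'I_3 -> Prop) : P 0 -> P 1 -> P 2 -> forall k, P k.
Proof.
move=> P0 P1 P2 [[|[|[|//]]] lt3].
- by have -> : Ordinal lt3 = 0 by apply/val_inj.
- by have -> : Ordinal lt3 = 1 by apply/val_inj.
- by have -> : Ordinal lt3 = 2 by apply/val_inj.
Qed.

Lemma bezout3 (a b c : int) : exists g u v w : int,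
  [/\ (g %| a)%Z, (g %| b)%Z, (g %| c)%Z & u * a + v * b + w * c = g].
Proof.
have [u [v uv]] := Bezoutz a b.
have [s [w sw]] := Bezoutz (gcdz a b) c.
exists (gcdz (gcdz a b) c), (s * u), (s * v), w; split.
- by rewrite (dvdz_trans (dvdz_gcdl _ _)) ?dvdz_gcdl.
- by rewrite (dvdz_trans (dvdz_gcdl _ _)) ?dvdz_gcdr.
- exact: dvdz_gcdr.
- by rewrite -sw -uv; ring.
Qed.

Lemma row3E (A : Type) (x y : 'rV[A]_3) :
  x 0 0 = y 0 0 -> x 0 1 = y 0 1 -> x 0 2 = y 0 2 -> x = y.
Proof. by move=> e0 e1 e2; apply/rowP; apply: ord3P. Qed.

Lemma primitive3_factor (x : 'rV[int]_3) : x <> 0 ->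
  exists (g : int) (x' : 'rV[int]_3), [/\ g != 0, x = g *: x' & primitive3 x'].
Proof.
move=> x0; have [g [u [v [w [/dvdzP[a xa] /dvdzP[b xb] /dvdzP[c xc] gE]]]]] :=
  bezout3 (x 0 0) (x 0 1) (x 0 2).
have g0 : g != 0.
  by apply/eqP => g0; apply: x0; apply: row3E;
     rewrite !mxE (xa, xb, xc) g0 mulr0.
pose r3 (p q s : int) : 'rV[int]_3 := \row_j [:: p; q; s]`_j.
exists g, (r3 a b c); split => //.
  by apply: row3E; rewrite !mxE /= mulrC.
exists (r3 u v w); rewrite !mxE /=; apply: (mulIf g0).
by rewrite mul1r -[RHS]gE xa xb xc; ring.
Qed.

(** If u . x = 1 then y - (u . y) x is a combination of the minors of x and y,
    so y is congruent to a multiple of x modulo n. *)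
Lemma primitive3_decomp (x y : 'rV[int]_3) (n : int) : primitive3 x ->
  (forall a b, (n %| minor2 x y a b)%Z) ->
  exists (m : int) (x' : 'rV[int]_3), y = m *: x + n *: x'.
Proof.
move=> [u ux] dvd; pose m := u 0 0 * y 0 0 + u 0 1 * y 0 1 + u 0 2 * y 0 2.
have yk (k : 'I_3) : (n %| (y 0 k - m * x 0 k)%R)%Z.
  have -> : y 0 k - m * x 0 k = u 0 0 * minor2 x y 0 k
      + u 0 1 * minor2 x y 1 k + u 0 2 * minor2 x y 2 k.
    by rewrite -{1}[y 0 k]mul1r -ux /m /minor2; ring.
  by rewrite !rpredD // dvdz_mull.
exists m, (\row_k ((y 0 k - m * x 0 k)%R %/ n)%Z).
apply/rowP => k; rewrite !mxE [n * _]mulrC (divzK (yk k)).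
by rewrite addrC subrK.
Qed.

Lemma minor2_gcd (x y : 'rV[int]_3) (a b : 'I_3) : minor2 x y a b != 0 ->
  exists n : int, [/\ n != 0, forall c d, (n %| minor2 x y c d)%Z
    & exists u v w : int, u * minor2 x y 0 1 + v * minor2 x y 0 2
        + w * minor2 x y 1 2 = n].
Proof.
move=> ab; have [n [u [v [w [n01 n02 n12 nE]]]]] :=
  bezout3 (minor2 x y 0 1) (minor2 x y 0 2) (minor2 x y 1 2).
have opp c d : minor2 x y d c = - minor2 x y c d.
  by rewrite /minor2; ring.
have id c : minor2 x y c c = 0 by rewrite /minor2; ring.
have dvd c d : (n %| minor2 x y c d)%Z.
  by move: c d; apply: ord3P; apply: ord3P;
     rewrite ?id ?dvdz0 // opp rpredN.
exists n; split => //; last by exists u, v, w.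
by apply/eqP => n0; move: (dvd a b); rewrite n0 dvd0z (negPf ab).
Qed.

Lemma index_cube_dvd (x y : 'rV[int]_3) (n r : int) : primitive3 x ->
  n != 0 -> (forall a b, (n %| minor2 x y a b)%Z) ->
  Fpol x y = - 3 * r ^+ 2 -> r ^+ 3 = phi x ^+ 2 * phi y ->
  (n ^+ 3 %| 108 * (Phi x x y - 3 * r) * r ^+ 2)%Z.
Proof.
move=> px n0 dvd Fr r3.
have [m [x' yE]] := primitive3_decomp x y n px dvd.
have TE : Phi x x y = 3 * m * phi x + n * Phi x x x'.
  by rewrite yE /Phi /phi !mxE; ring.
have UE : Phi x y y = 3 * m ^+ 2 * phi x + 2 * m * n * Phi x x x'
    + n ^+ 2 * Phi x x' x'.
  by rewrite yE /Phi /phi !mxE; ring.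
have VE : phi y = m ^+ 3 * phi x + m ^+ 2 * n * Phi x x x'
    + m * n ^+ 2 * Phi x x' x' + n ^+ 3 * phi x'.
  by rewrite yE /Phi /phi !mxE; ring.
move: Fr r3; rewrite /Fpol UE VE TE; exact: cube_dvd_contact.
Qed.

(** If T = 3 r then phi (s x + t y) = S (s + (r / S) t)^3, so the point
    q = S y - r x satisfies phi q = 0, Phi x x q = 0 and Phi x q q = 0.  A point
    of the cuspidal cubic with such a contact along a line through x is its
    cusp, with tangent x_0 = 0, or its flex, with tangent x_2 = 0; the
    conditions on x exclude both tangents and the cubic itself. *)
Lemma not_triple_contact (x y : 'rV[int]_3) (a b : 'I_3) (r : int) :
  x 0 0 != 0 -> x 0 2 != 0 -> phi x != 0 -> minor2 x y a b != 0 ->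
  Fpol x y = - 3 * r ^+ 2 -> r ^+ 3 = phi x ^+ 2 * phi y ->
  Phi x x y - 3 * r != 0.
Proof.
move=> x0 x2 S0 ab Fr r3; apply/eqP => Tr.
pose q := phi x *: y - r *: x.
have TE : Phi x x y = 3 * r by apply/eqP; rewrite -subr_eq0 Tr.
have UE : phi x * Phi x y y = 3 * r ^+ 2.
  apply: (@mulfI _ (4 : int)) => //.
  by move: Fr; rewrite /Fpol TE -[4 * phi x * _]mulrA => Fr; lra.
have xxq : Phi x x q = 0.
  transitivity (phi x * (Phi x x y - 3 * r)); last by rewrite Tr mulr0.
  by rewrite /q /Phi /phi !mxE; ring.
have xqq : Phi x q q = 0.
  transitivity (phi x * (phi x * Phi x y y) - 2 * r * phi x * Phi x x y
     + 3 * r ^+ 2 * phi x); last by rewrite UE TE; ring.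
  by rewrite /q /Phi /phi !mxE; ring.
have qq : phi q = 0.
  transitivity (phi x * (phi x ^+ 2 * phi y) - phi x * r * (phi x * Phi x y y)
    + phi x * r ^+ 2 * Phi x x y - r ^+ 3 * phi x).
    by rewrite /q /Phi /phi !mxE; ring.
  by rewrite -r3 UE TE; ring.
have [q00|q00] := eqVneq (q 0 0) 0.
  have q10 : q 0 1 = 0.
    move/eqP: qq; rewrite /phi q00 expr0n mul0r sub0r oppr_eq0.
    by rewrite expf_eq0 => /andP[_ /eqP].
  have q20 : q 0 2 = 0.
    move/eqP: xxq; rewrite /Phi q00 q10 !mulr0 !addr0 ?subr0 mulf_eq0.
    by rewrite mulf_eq0 (negPf x0) => /eqP.
  have qk : forall k, phi x * y 0 k = r * x 0 k.
    move=> k; apply/eqP; rewrite -subr_eq0; apply/eqP.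
    by have : q 0 k = 0; [apply: (ord3P (fun k => q 0 k = 0))|rewrite !mxE].
  move/eqP: ab; apply; apply: (mulfI S0); rewrite mulr0.
  transitivity (x 0 a * (phi x * y 0 b) - x 0 b * (phi x * y 0 a)).
    by rewrite /minor2; ring.
  by rewrite !qk; ring.
have x2E : q 0 0 ^+ 3 * x 0 2
    = 3 * q 0 0 * q 0 1 ^+ 2 * x 0 1 - 2 * q 0 1 ^+ 3 * x 0 0.
  apply/eqP; rewrite -subr_eq0; apply/eqP.
  transitivity (q 0 0 * Phi x q q - 2 * x 0 0 * phi q).
    by rewrite /Phi /phi; ring.
  by rewrite xqq qq; ring.
have : q 0 1 * (x 0 0 * q 0 1 - x 0 1 * q 0 0) ^+ 2 = 0.
  apply: (@mulfI _ (- 3 : int)) => //; rewrite mulr0.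
  transitivity (q 0 0 ^+ 2 * Phi x x q - x 0 0 ^+ 2 * phi q - 2 * x 0 0 *
   (q 0 0 ^+ 3 * x 0 2 - (3 * q 0 0 * q 0 1 ^+ 2 * x 0 1
     - 2 * q 0 1 ^+ 3 * x 0 0))); last by rewrite xxq qq x2E; ring.
  by rewrite /Phi /phi; ring.
move/eqP; rewrite mulf_eq0 => /orP[/eqP q10|].
  move/eqP: x2E; rewrite q10 expr0n /= !mulr0 !mul0r subr0 mulf_eq0.
  by rewrite expf_eq0 (negPf q00) (negPf x2).
rewrite expf_eq0 /= subr_eq0 => /eqP qx.
move/eqP: S0; apply; apply: (mulfI (expf_neq0 3 q00)); rewrite mulr0.
transitivity (x 0 0 ^+ 2 * (q 0 0 ^+ 3 * x 0 2) - (x 0 1 * q 0 0) ^+ 3).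
  by rewrite /phi; ring.
rewrite x2E -qx.
transitivity (3 * x 0 0 ^+ 2 * q 0 1 ^+ 2 * (x 0 1 * q 0 0)
   - 3 * x 0 0 ^+ 3 * q 0 1 ^+ 3); first by ring.
by rewrite -qx; ring.
Qed.

(** The affine part of the cubic x_0^2 x_2 = x_1^3 is parametrised by the slope
    b / a = x_1 / x_0. *)
Lemma phi_eq0_primitive (x : 'rV[int]_3) : primitive3 x -> x 0 0 != 0 ->
  phi x = 0 -> exists h a b : int,
    [/\ `|h| = 1, coprimez a b &
     [/\ x 0 0 = h * a ^+ 3, x 0 1 = h * a ^+ 2 * b & x 0 2 = h * b ^+ 3]].
Proof.
move=> [u ux] x0 px.
have [g [a [b [g0 cab xa xb]]]] : exists g a b : int,
    [/\ g != 0, coprimez a b, x 0 0 = a * g & x 0 1 = b * g].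
  exact: int_lowest_terms.
have a0 : a != 0 by apply: contraNneq x0 => a0; rewrite xa a0 mul0r.
have eq1 : a ^+ 2 * x 0 2 = g * b ^+ 3.
  apply: (mulIf (expf_neq0 2 g0)); apply/eqP; rewrite -subr_eq0 -px.
  by rewrite /phi xa xb; apply/eqP; ring.
have /dvdzP[h gh] : (a ^+ 2 %| g)%Z.
  have cab' : coprimez (a ^+ 2) (b ^+ 3).
    by apply: coprimezXl; apply: coprimezXr.
  by rewrite -(Gauss_dvdzl _ cab') -eq1 dvdz_mulr.
have xc : x 0 2 = h * b ^+ 3.
  by apply: (mulfI (expf_neq0 2 a0)); rewrite eq1 gh; ring.
exists h, a, b; split => //; last first.
  by split => //; rewrite (xa, xb) gh; ring.
have : (h %| 1)%Z.
  apply/dvdzP; exists (u 0 0 * a ^+ 3 + u 0 1 * a ^+ 2 * b + u 0 2 * b ^+ 3).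
  transitivity (u 0 0 * x 0 0 + u 0 1 * x 0 1 + u 0 2 * x 0 2).
    by rewrite ux.
  by rewrite xa xb xc gh; ring.
by rewrite dvdz1 => /eqP h1; rewrite -abszE h1.
Qed.

(** The Grassmann-Pluecker exchange relation; [minor2 c d p q] is, up to sign,
    the determinant of c, d and a standard basis vector. *)
Lemma plucker_exchange (A : comPzRingType) (a b c d e : 'rV[A]_3) (p q : 'I_3) :
  minor2 c d p q * det3 a b e = det3 a b c * minor2 e d p q
    + det3 a b d * minor2 c e p q + minor2 a b p q * det3 c d e.
Proof.
by move: p q; apply: ord3P; apply: ord3P; rewrite /det3 /minor2; ring.
Qed.

(** For x, y, z in one plane, the cross products of x with y and with z are
    multiples of the same normal vector; n being the gcd of the first one, n
    times the second is an integral multiple of the first. *)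
Lemma index_cofactor (x y z : 'rV[int]_3) (a b : 'I_3) (n u v w : int) :
  det3 x z y = 0 -> minor2 x z a b != 0 -> n != 0 ->
  u * minor2 x y 0 1 + v * minor2 x y 0 2 + w * minor2 x y 1 2 = n ->
  exists c : int, c != 0 /\
    forall p q, n * minor2 x z p q = c * minor2 x y p q.
Proof.
move=> det ab n0 nE.
pose c := u * minor2 x z 0 1 + v * minor2 x z 0 2 + w * minor2 x z 1 2.
have prop p q : n * minor2 x z p q = c * minor2 x y p q.
  apply/eqP; rewrite -subr_eq0 -nE.
  have -> : (u * minor2 x y 0 1 + v * minor2 x y 0 2 + w * minor2 x y 1 2)
     * minor2 x z p q - c * minor2 x y p q = det3 x z y * (
       u * minor2 (\row_k (k == 2)%:R) x p q
     - v * minor2 (\row_k (k == 1)%:R) x p q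
     + w * minor2 (\row_k (k == 0)%:R) x p q).
    by move: p q; apply: ord3P; apply: ord3P;
       rewrite /c /det3 /minor2 !mxE /=; ring.
  by rewrite det mul0r.
exists c; split => //; apply/eqP => c0.
by move: (prop a b); rewrite c0 mul0r => /eqP;
  rewrite mulf_eq0 (negPf n0) (negPf ab).
Qed.

(** * Size estimates near the line spanned by (1, xi, xi^3) *)

Definition approx_by {R : realType} (xi X L : R) (v : 'rV[R]_3) : Prop :=
  [/\ `|v 0 0| <= X, `|v 0 1| <= X, `|v 0 2| <= X,
      `|v 0 1 - v 0 0 * xi| <= L
    & `|v 0 2 - v 0 0 * xi ^+ 3| <= L].

Lemma approx_by_norm3 (R : realType) (xi : R) (v : 'rV[R]_3) :
  approx_by xi (norm3 v) (Ldist xi v) v.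
Proof.
by split; rewrite !le_max lexx ?orbT.
Qed.

Lemma normM_le (R : realType) (a b A B : R) :
  `|a| <= A -> `|b| <= B -> `|a * b| <= A * B.
Proof. by move=> aA bB; rewrite normrM ler_pM. Qed.

Lemma normD_le (R : realType) (a b A B : R) :
  `|a| <= A -> `|b| <= B -> `|a + b| <= A + B.
Proof. by move=> aA bB; apply: le_trans (ler_normD _ _) (lerD aA bB). Qed.

Lemma normB_le (R : realType) (a b A B : R) :
  `|a| <= A -> `|b| <= B -> `|a - b| <= A + B.
Proof. by move=> aA bB; apply: normD_le; rewrite ?normrN. Qed.

Lemma normX_le (R : realType) (a A : R) n : `|a| <= A -> `|a ^+ n| <= A ^+ n.
Proof.
by move=> aA; rewrite normrX lerXn2r // nnegrE (le_trans _ aA).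
Qed.

Lemma normn_le (R : realType) (n : nat) : `|n%:R : R| <= n%:R.
Proof. by rewrite normr_nat. Qed.

(** Bounds the norm of a polynomial expression by the same expression in the
    bounds of its atoms, provided that every subtraction becomes a sum there. *)
Ltac bound_norm := repeat first
  [ assumption | exact: normn_le | apply: normX_le | apply: normM_le
  | apply: normB_le | apply: normD_le ].

Lemma phi_bound (R : realType) (xi M X L : R) (x : 'rV[R]_3) :
  1 <= M -> `|xi| <= M -> 1 <= X -> 0 <= L -> approx_by xi X L x ->
  `|phi x| <= 4 * M ^+ 2 * X ^+ 2 * L.
Proof.
move=> M1 xiM X1 L0 [x0 x1 x2 d1 d2].
set e1 := x 0 1 - x 0 0 * xi in d1; set e2 := x 0 2 - x 0 0 * xi ^+ 3 in d2.
have -> : phi x = x 0 0 ^+ 2 * e2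
    - e1 * (x 0 1 ^+ 2 + x 0 1 * (x 0 0 * xi) + (x 0 0 * xi) ^+ 2).
  by rewrite /phi /e1 /e2; ring.
apply: (@le_trans _ _ (X ^+ 2 * L
    + L * (X ^+ 2 + X * (X * M) + (X * M) ^+ 2))).
  by bound_norm.
have -> : X ^+ 2 * L + L * (X ^+ 2 + X * (X * M) + (X * M) ^+ 2)
  = (2 + M + M ^+ 2) * (X ^+ 2 * L) by ring.
have X0 : 0 <= X by lra.
by rewrite -[leRHS]mulrA ler_wpM2r ?mulr_ge0 ?exprn_ge0 //; nra.
Qed.

(** The coefficient of y in Phi x x y when y runs over the line spanned by
    (1, xi, xi^3). *)
Definition tangent {R : realType} (xi : R) (x : 'rV[R]_3) : R :=
  2 * x 0 0 * (x 0 2 - x 0 0 * xi ^+ 3)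
  - 3 * xi * (x 0 1 - x 0 0 * xi) * (x 0 1 + x 0 0 * xi).

(** What remains of Phi x x y after removing the part along that line. *)
Definition polar2 {R : realType} (xi : R) (x y : 'rV[R]_3) : R :=
  x 0 0 ^+ 2 * (y 0 2 - y 0 0 * xi ^+ 3)
  - 3 * x 0 1 ^+ 2 * (y 0 1 - y 0 0 * xi).

Lemma tangent_bound (R : realType) (xi M X L : R) (x : 'rV[R]_3) :
  1 <= M -> `|xi| <= M -> 1 <= X -> 0 <= L -> approx_by xi X L x ->
  `|tangent xi x| <= 8 * M ^+ 2 * (X * L).
Proof.
move=> M1 xiM X1 L0 [x0 x1 x2 d1 d2].
apply: (@le_trans _ _ (2 * X * L + 3 * M * L * (X + X * M))).
  by rewrite /tangent; bound_norm.
have -> : 2 * X * L + 3 * M * L * (X + X * M)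
  = (2 + 3 * M + 3 * M ^+ 2) * (X * L) by ring.
have X0 : 0 <= X by lra.
by rewrite ler_wpM2r ?mulr_ge0 //; nra.
Qed.

Lemma polar2_bound (R : realType) (xi X L Y N : R) (x y : 'rV[R]_3) :
  approx_by xi X L x -> approx_by xi Y N y ->
  `|polar2 xi x y| <= 4 * (X ^+ 2 * N).
Proof.
move=> [x0 x1 x2 _ _] [_ _ _ e1 e2].
apply: (@le_trans _ _ (X ^+ 2 * N + 3 * X ^+ 2 * N)); last by lra.
by rewrite /polar2; bound_norm.
Qed.

Lemma Phi_bound (R : realType) (xi M X L Y N : R) (x y : 'rV[R]_3) :
  1 <= M -> `|xi| <= M -> 1 <= X -> X <= Y -> 0 <= N -> N <= L -> L <= 1 ->
  approx_by xi X L x -> approx_by xi Y N y ->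
  `|Phi x x y| <= 12 * M ^+ 2 * (X * Y * L).
Proof.
move=> M1 xiM X1 XY N0 NL L1 ax ay.
have [y0 _ _ _ _] := ay; have L0 := le_trans N0 NL.
have tle := @tangent_bound R xi M X L x M1 xiM X1 L0 ax.
have ble := @polar2_bound R xi X L Y N x y ax ay.
have -> : Phi x x y = y 0 0 * tangent xi x + polar2 xi x y.
  by rewrite /Phi /tangent /polar2; ring.
apply: (@le_trans _ _ (Y * (8 * M ^+ 2 * (X * L)) + 4 * (X ^+ 2 * N))).
  by bound_norm.
have P0 : 0 <= X * Y * L by rewrite !mulr_ge0 //; lra.
have : X * Y * L <= M ^+ 2 * (X * Y * L).
  by rewrite ler_peMl // exprn_ege1.
have : X ^+ 2 * N <= X * Y * L.
  by rewrite expr2 -!mulrA ler_wpM2l ?ler_pM //; lra.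
set P := X * Y * L; rewrite -/P.
have -> : Y * (8 * M ^+ 2 * (X * L)) = 8 * (M ^+ 2 * P) by rewrite /P; ring.
lra.
Qed.

(** Expand F in powers of y_0.  The coefficient of y_0^2 is
    tangent^2 - 4 phi(x) (d2 - 3 xi^2 d1), which collapses to
    d1^3 (4 d2 - 3 xi^2 d1), with d1 = x_1 - x_0 xi and d2 = x_2 - x_0 xi^3:
    the terms in d of degree two and three times powers of x_0 cancel.  This
    cancellation is what the factor 4 in F achieves.  The other
    coefficients contain at least one factor N. *)
Lemma Fpol_bound (R : realType) (xi M X L Y N : R) (x y : 'rV[R]_3) :
  1 <= M -> `|xi| <= M -> 1 <= X -> X <= Y -> 0 <= N -> N <= L -> L <= 1 ->
  approx_by xi X L x -> approx_by xi Y N y ->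
  `|Fpol x y| <= 7 * M ^+ 2 * (Y * L ^+ 2) ^+ 2
                 + 256 * M ^+ 3 * (X ^+ 3 * Y * L * N).
Proof.
move=> M1 xiM X1 XY N0 NL L1 ax ay.
have [x0 x1 x2 d1 d2] := ax; have [y0 y1 y2 e1 e2] := ay.
have L0 := le_trans N0 NL.
have Sle := @phi_bound R xi M X L x M1 xiM X1 L0 ax.
have tle := @tangent_bound R xi M X L x M1 xiM X1 L0 ax.
have ble := @polar2_bound R xi X L Y N x y ax ay.
pose g := 2 * x 0 0 * (y 0 2 - y 0 0 * xi ^+ 3)
  - 6 * x 0 1 * xi * (y 0 1 - y 0 0 * xi).
pose w := 3 * x 0 1 * (y 0 1 - y 0 0 * xi) ^+ 2.
pose k := (x 0 1 - x 0 0 * xi) ^+ 3 * (4 * (x 0 2 - x 0 0 * xi ^+ 3)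
  - 3 * xi ^+ 2 * (x 0 1 - x 0 0 * xi)).
have X0 : 0 <= X by lra.
have Y0 : 0 <= Y by lra.
have M0 : 0 <= M by lra.
have gle : `|g| <= 8 * M * (X * N).
  apply: (@le_trans _ _ (2 * X * N + 6 * X * M * N)).
    by rewrite /g; bound_norm.
  have : X * N <= M * (X * N) by rewrite ler_peMl // mulr_ge0.
  by lra.
have wle : `|w| <= 3 * X * N ^+ 2 by rewrite /w; bound_norm.
have kle : `|k| <= 7 * M ^+ 2 * L ^+ 4.
  apply: (@le_trans _ _ (L ^+ 3 * (4 * L + 3 * M ^+ 2 * L))).
    by rewrite /k; bound_norm.
  have : L ^+ 4 <= M ^+ 2 * L ^+ 4 by rewrite ler_peMl ?exprn_ge0 ?exprn_ege1.
  by lra.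
have -> : Fpol x y = y 0 0 ^+ 2 * k
    + (y 0 0 * (2 * tangent xi x * polar2 xi x y - 4 * phi x * g)
    + (polar2 xi x y ^+ 2 + 4 * phi x * w)).
  by rewrite /Fpol /Phi /phi /tangent /polar2 /g /w /k; ring.
apply: (@le_trans _ _ (Y ^+ 2 * (7 * M ^+ 2 * L ^+ 4)
  + (Y * (2 * (8 * M ^+ 2 * (X * L)) * (4 * (X ^+ 2 * N))
     + 4 * (4 * M ^+ 2 * X ^+ 2 * L) * (8 * M * (X * N)))
     + ((4 * (X ^+ 2 * N)) ^+ 2
        + 4 * (4 * M ^+ 2 * X ^+ 2 * L) * (3 * X * N ^+ 2))))).
  by bound_norm.
set P := X ^+ 3 * Y * L * N.
have P0 : 0 <= P by rewrite /P !mulr_ge0 ?exprn_ge0.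
have t1 : M ^+ 2 * P <= M ^+ 3 * P.
  by rewrite ler_wpM2r // ler_weXn2l.
have t2 : P <= M ^+ 2 * P by rewrite ler_peMl // exprn_ege1.
have t3 : X ^+ 4 * N ^+ 2 <= P.
  have -> : X ^+ 4 * N ^+ 2 = X ^+ 2 * N * (X ^+ 2 * N) by ring.
  have -> : P = X ^+ 2 * N * (X * Y * L) by rewrite /P; ring.
  rewrite ler_wpM2l ?mulr_ge0 ?exprn_ge0 //.
  by rewrite expr2 -!mulrA ler_wpM2l ?ler_pM //; lra.
have t4 : X ^+ 3 * L * N ^+ 2 <= P.
  have -> : X ^+ 3 * L * N ^+ 2 = N * (X ^+ 3 * L * N) by ring.
  have -> : P = Y * (X ^+ 3 * L * N) by rewrite /P; ring.
  by rewrite ler_wpM2r ?mulr_ge0 ?exprn_ge0 //; lra.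
have t5 : M ^+ 2 * (X ^+ 3 * L * N ^+ 2) <= M ^+ 2 * P.
  by rewrite ler_wpM2l ?exprn_ge0.
have -> : Y ^+ 2 * (7 * M ^+ 2 * L ^+ 4) + (Y * (2 * (8 * M ^+ 2 * (X * L))
     * (4 * (X ^+ 2 * N))
     + 4 * (4 * M ^+ 2 * X ^+ 2 * L) * (8 * M * (X * N)))
     + ((4 * (X ^+ 2 * N)) ^+ 2
        + 4 * (4 * M ^+ 2 * X ^+ 2 * L) * (3 * X * N ^+ 2)))
  = 7 * M ^+ 2 * (Y * L ^+ 2) ^+ 2 + (64 * (M ^+ 2 * P) + 128 * (M ^+ 3 * P)
    + 16 * (X ^+ 4 * N ^+ 2) + 48 * (M ^+ 2 * (X ^+ 3 * L * N ^+ 2))).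
  by rewrite /P; ring.
by lra.
Qed.

Lemma minor2_upper (R : realType) (xi X L Y N : R) (x y : 'rV[R]_3) (k : 'I_3) :
  approx_by xi X L x -> approx_by xi Y N y -> k = 1 \/ k = 2 ->
  `|minor2 x y 0 k| <= X * N + L * Y.
Proof.
move=> [x0 x1 x2 d1 d2] [y0 y1 y2 e1 e2] k12.
case: k12 => ->.
  have -> : minor2 x y 0 1 = x 0 0 * (y 0 1 - y 0 0 * xi)
    - (x 0 1 - x 0 0 * xi) * y 0 0 by rewrite /minor2; ring.
  by bound_norm.
have -> : minor2 x y 0 2 = x 0 0 * (y 0 2 - y 0 0 * xi ^+ 3)
  - (x 0 2 - x 0 0 * xi ^+ 3) * y 0 0 by rewrite /minor2; ring.
by bound_norm.
Qed.

(** Subtracting multiples of the first column from the two others leaves small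
    entries there, and each term of the expansion has two of them. *)
Lemma det3_bound (R : realType) (xi X L Y N Z P : R) (x y z : 'rV[R]_3) :
  0 <= X -> X <= Y -> Y <= Z -> 0 <= P -> P <= N -> N <= L ->
  approx_by xi X L x -> approx_by xi Y N y -> approx_by xi Z P z ->
  `|det3 x y z| <= 6 * (Z * L * N).
Proof.
move=> X0 XY YZ P0 PN NL ax ay [z0 z1 z2 f1 f2].
have m1 := @minor2_upper R xi X L Y N x y 1 ax ay (or_introl erefl).
have m2 := @minor2_upper R xi X L Y N x y 2 ax ay (or_intror erefl).
have [x0 x1 x2 d1 d2] := ax; have [y0 y1 y2 e1 e2] := ay.
have -> : det3 x y z = z 0 0 * ((x 0 1 - x 0 0 * xi)
  * (y 0 2 - y 0 0 * xi ^+ 3) - (x 0 2 - x 0 0 * xi ^+ 3)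
  * (y 0 1 - y 0 0 * xi)) - (z 0 1 - z 0 0 * xi) * minor2 x y 0 2
  + (z 0 2 - z 0 0 * xi ^+ 3) * minor2 x y 0 1.
  by rewrite /det3 /minor2; ring.
apply: (@le_trans _ _ (Z * (L * N + L * N) + P * (X * N + L * Y)
   + P * (X * N + L * Y))).
  by bound_norm.
have h1 : P * (X * N) <= L * (Z * N).
  by rewrite ler_pM ?ler_wpM2r ?mulr_ge0 //; lra.
have h2 : P * (L * Y) <= N * (L * Z).
  by rewrite ler_pM ?ler_wpM2l ?mulr_ge0 //; lra.
by lra.
Qed.

(** * Integral points inside real space *)

Lemma Phi_embZ (R : realType) (x y z : 'rV[int]_3) :
  Phi (embZ R x) (embZ R y) (embZ R z) = (Phi x y z)%:~R.
Proof. by rewrite /Phi !mxE; ring. Qed.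

Lemma Fpol_embZ (R : realType) (x y : 'rV[int]_3) :
  Fpol (embZ R x) (embZ R y) = (Fpol x y)%:~R.
Proof. by rewrite /Fpol /Phi /phi !mxE; ring. Qed.

Lemma minor2_embZ (R : realType) (x y : 'rV[int]_3) a b :
  minor2 (embZ R x) (embZ R y) a b = (minor2 x y a b)%:~R.
Proof. by rewrite /minor2 !mxE; ring. Qed.

Lemma det3_embZ (R : realType) (x y z : 'rV[int]_3) :
  det3 (embZ R x) (embZ R y) (embZ R z) = (det3 x y z)%:~R.
Proof. by rewrite /det3 /minor2 !mxE; ring. Qed.

Lemma free3E (F : fieldType) (x y z : 'rV[F]_3) :
  free [:: x; y; z] = (det3 x y z != 0).
Proof.
pose A : 'M[F]_3 := \matrix_(i, j) ([:: x; y; z]`_i) 0 j.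
have mulA (v : 'rV_3) : v *m A = \sum_(i < 3) v 0 i *: [:: x; y; z]`_i.
  apply/rowP => j; rewrite !mxE summxE.
  by apply: eq_bigr => i _; rewrite !mxE.
have detA : \det A = det3 x y z.
  rewrite (expand_det_row _ ord0) !big_ord_recl big_ord0 /cofactor.
  rewrite !(expand_det_row _ ord0) !big_ord_recl !big_ord0 /cofactor.
  rewrite !det_mx11 !mxE /=.
  rewrite /det3 /minor2.
  have ordE (i j : 'I_3) : val i = val j -> i = j by apply: val_inj.
  rewrite (ordE (lift ord0 ord0) 1) // (ordE (lift ord0 (lift ord0 ord0)) 2) //.
  rewrite (ordE ord0 0) // (ordE (lift ord0 (lift (lift ord0 ord0) 0)) 1) //.
  rewrite (ordE (lift 1 ord0) 0) // (ordE (lift 1 (lift ord0 0)) 2) //.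
  rewrite (ordE (lift 1 (lift (lift ord0 ord0) 0)) 0) //.
  rewrite (ordE (lift 2 ord0) 0) // (ordE (lift 2 (lift ord0 0)) 1) //.
  rewrite (ordE (lift 2 (lift (lift ord0 ord0) 0)) 0) //.
  rewrite ?(ordE (lift 1 (lift ord0 ord0)) 2) //.
  rewrite ?(ordE (lift 2 (lift ord0 ord0)) 1) //.
  by rewrite /bump /=; ring.
rewrite -detA; apply/idP/idP.
  move=> /(@freeP _ _ 3 [tuple x; y; z]) free3; apply/det0P => -[v v0].
  rewrite mulA => /free3 vi; move/eqP: v0; apply; apply/rowP => i.
  by rewrite mxE vi.
move=> /det0P nodep; apply/(@freeP _ _ 3 [tuple x; y; z]) => k k0 i.
apply/eqP/negPn/negP => ki; apply: nodep; exists (\row_j k j).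
  by apply/eqP => /rowP/(_ i); rewrite !mxE; apply/eqP.
by rewrite mulA -[RHS]k0; apply: eq_bigr => j _; rewrite mxE.
Qed.

Lemma norm3_ge0 (R : realType) (v : 'rV[R]_3) : 0 <= norm3 v.
Proof. by rewrite /norm3 !le_max !normr_ge0. Qed.

Lemma Ldist_ge0 (R : realType) (xi : R) (v : 'rV[R]_3) : 0 <= Ldist xi v.
Proof. by rewrite /Ldist le_max normr_ge0. Qed.

Lemma norm3_embZ_scale (R : realType) (g : int) (v : 'rV[int]_3) :
  norm3 (embZ R (g *: v)) = `|g|%:~R * norm3 (embZ R v).
Proof.
rewrite intr_norm /norm3 !maxr_pMr //.
by rewrite !mxE -!normrM -!intrM.
Qed.

Lemma Ldist_embZ_scale (R : realType) (xi : R) (g : int) (v : 'rV[int]_3) :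
  Ldist xi (embZ R (g *: v)) = `|g|%:~R * Ldist xi (embZ R v).
Proof.
rewrite intr_norm /Ldist !maxr_pMr // !mxE -!normrM.
by congr Num.max; congr `| _ |; ring.
Qed.

Lemma norm3_embZ_nat (R : realType) (v : 'rV[int]_3) :
  exists n : nat, norm3 (embZ R v) = n%:R.
Proof.
have maxn_nat (m n : nat) : exists k : nat, Num.max (m%:R : R) n%:R = k%:R.
  by case: (leP (m%:R : R) n%:R) => _; [exists n|exists m].
have absn (a : int) : `|a%:~R : R| = (`|a|%N)%:R.
  by rewrite -intr_norm -abszE.
rewrite /norm3 !mxE !absn.
have [k ->] := maxn_nat `|(v 0 0)%R|%N `|(v 0 1)%R|%N.
exact: maxn_nat.
Qed.

Lemma norm1_int (R : realType) (a : int) : a != 0 -> 1 <= `|a%:~R : R|.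
Proof.
by move=> a0; rewrite -intr_norm -[1]/(1%:~R) ler_int -abszE lez_nat absz_gt0.
Qed.

Lemma eq_le_norm (R : realType) (a b : R) : a = b -> `|a| <= `|b|.
Proof. by move=> ->. Qed.

(** Write x = +- (a^3, a^2 b, b^3).  The integers q1 = a y_1 - b y_0 and, once
    q1 = 0 and y_0 = a m, q2 = a^2 y_2 - m b^3 satisfy a^2 q1 << X N and
    a q2 << X N, where X is the norm of x and N the distance of y.  If one of
    them is nonzero then a << X N, which is the bound.  If both vanish then y
    is a multiple of x, which its norm forbids. *)
Lemma phi_eq0_bound (R : realType) (xi : R) (x y : 'rV[int]_3) :
  primitive3 x -> x 0 0 != 0 -> phi x = 0 -> y <> 0 ->
  norm3 (embZ R y) < norm3 (embZ R x) ->
  Ldist xi (embZ R x) <= Ldist xi (embZ R y) ->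
  `|(x 0 0)%:~R| <= (2 * norm3 (embZ R x) * Ldist xi (embZ R y)) ^+ 3.
Proof.
move=> px x0 phix y0 yx Lxy.
have [h [a [b [h1 cab [xa xb xc]]]]] := phi_eq0_primitive x px x0 phix.
have [ax0 _ _ ax1 ax2] := @approx_by_norm3 R xi (embZ R x).
have [ay0 _ _ ay1 ay2] := @approx_by_norm3 R xi (embZ R y).
have X0 := @norm3_ge0 R (embZ R x); have N0 := @Ldist_ge0 R xi (embZ R y).
set X := norm3 (embZ R x) in yx ax0 X0 *.
set L := Ldist xi (embZ R x) in Lxy ax1 ax2.
set Y := norm3 (embZ R y) in yx ay0.
set N := Ldist xi (embZ R y) in Lxy ay1 ay2 N0 *.
have {}ax1 := le_trans ax1 Lxy; have {}ax2 := le_trans ax2 Lxy.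
rewrite !mxE in ax0 ax1 ax2 ay0 ay1 ay2.
have {}ay0 := le_trans ay0 (ltW yx).
have hR : `|h%:~R : R| = 1 by rewrite -intr_norm h1.
have hM (t : R) : `|h%:~R * t| = `|t| by rewrite normrM hR mul1r.
have a0 : a != 0 by apply: contraNneq x0 => a0; rewrite xa a0 expr0n mulr0.
have a1 := norm1_int R _ a0.
have x0E : `|(x 0 0)%:~R : R| = `|a%:~R| ^+ 3.
  by rewrite xa intrM rmorphXn normrM hR mul1r normrX.
suff aXN : `|a%:~R : R| <= 2 * X * N by rewrite x0E lerXn2r ?nnegrE ?mulr_ge0.
have eX : `|a%:~R ^+ 3 : R| <= X by rewrite normrX -x0E.
have e1 : `|a%:~R ^+ 3 * xi - a%:~R ^+ 2 * b%:~R| <= N.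
  apply: le_trans ax1; rewrite -[leLHS]hM -normrN xa xb.
  by apply: eq_le_norm; ring.
have e2 : `|a%:~R ^+ 3 * xi ^+ 3 - b%:~R ^+ 3| <= N.
  apply: le_trans ax2; rewrite -[leLHS]hM -normrN xa xc.
  by apply: eq_le_norm; ring.
have [q1|q1] := eqVneq (a * y 0 1 - b * y 0 0) 0; last first.
  have : `|a%:~R ^+ 2 * (a * y 0 1 - b * y 0 0)%:~R : R| <= X * N + X * N.
    have -> : a%:~R ^+ 2 * (a * y 0 1 - b * y 0 0)%:~R
      = a%:~R ^+ 3 * ((y 0 1)%:~R - (y 0 0)%:~R * xi)
        + (y 0 0)%:~R * (a%:~R ^+ 3 * xi - a%:~R ^+ 2 * b%:~R) :> R by ring.
    by bound_norm.
  have := norm1_int R _ q1; rewrite normrM normrX; set q := `| _%:~R|; nra.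
have /dvdzP[m ym] : (a %| (y 0 0)%R)%Z.
  rewrite -(@Gauss_dvdzr _ b) //; apply/dvdzP; exists (y 0 1).
  by apply/eqP; rewrite -subr_eq0 -oppr_eq0 -q1; apply/eqP; ring.
have ym1 : y 0 1 = b * m.
  apply: (mulfI a0); apply/eqP; rewrite -subr_eq0 -q1 ym; apply/eqP; ring.
have [q2|q2] := eqVneq (a ^+ 2 * y 0 2 - m * b ^+ 3) 0; last first.
  have : `|a%:~R * (a ^+ 2 * y 0 2 - m * b ^+ 3)%:~R : R| <= X * N + X * N.
    have -> : a%:~R * (a ^+ 2 * y 0 2 - m * b ^+ 3)%:~R
      = a%:~R ^+ 3 * ((y 0 2)%:~R - (y 0 0)%:~R * xi ^+ 3)
        + (y 0 0)%:~R * (a%:~R ^+ 3 * xi ^+ 3 - b%:~R ^+ 3) :> R.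
      by rewrite ym; ring.
    by bound_norm.
  have := norm1_int R _ q2; rewrite normrM; set q := `| _%:~R|; nra.
have /dvdzP[m' mm] : (a ^+ 2 %| m)%Z.
  have cab' : coprimez (a ^+ 2) (b ^+ 3).
    by apply: coprimezXl; apply: coprimezXr.
  rewrite -(Gauss_dvdzl _ cab'); apply/dvdzP; exists (y 0 2).
  by apply/eqP; rewrite -subr_eq0 -oppr_eq0 -q2; apply/eqP; ring.
have hh : h * h = 1.
  by rewrite -expr2 -[h ^+ 2]real_normK ?num_real // h1 expr1n.
have y2 : y 0 2 = m' * b ^+ 3.
  apply: (mulfI (expf_neq0 2 a0)); apply/eqP; rewrite -subr_eq0 -q2 mm.
  by apply/eqP; ring.
have yE : y = (m' * h) *: x.
  apply: row3E; rewrite !mxE ?xa ?xb ?xc -?mulrA ?[h * (h * _)]mulrA hh mul1r.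
  - by rewrite ym mm; ring.
  - by rewrite ym1 mm; ring.
  - by rewrite y2.
have m'h : m' * h != 0.
  by apply/eqP => mh; apply: y0; rewrite yE mh scale0r.
exfalso; move: yx; rewrite /Y yE norm3_embZ_scale -/X intr_norm.
by rewrite ltNge ler_peMl // norm1_int.
Qed.

(** * Minimal points *)

(** A nonzero integral point at distance less than 1/2 cannot have x_0 = 0,
    since its other coordinates would then vanish too. *)
Lemma coord0_bound (R : realType) (xi : R) (v : 'rV[int]_3) : v <> 0 ->
  Ldist xi (embZ R v) < 2^-1 ->
  v 0 0 != 0 /\
  norm3 (embZ R v) <= (2 + `|xi| + `|xi| ^+ 3) * `|(v 0 0)%:~R|.
Proof.
move=> vn0 Lv; have [_ _ _ d1 d2] := @approx_by_norm3 R xi (embZ R v).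
have {d1} d1 := le_lt_trans d1 Lv; have {d2} d2 := le_lt_trans d2 Lv.
have v0 : v 0 0 != 0.
  apply/eqP => v0; apply: vn0.
  have small (a : int) : `|a%:~R : R| < 2^-1 -> a = 0.
    move=> a2; apply/eqP; apply: contraTT isT => /(norm1_int R _) a1.
    by exfalso; lra.
  move: d1 d2; rewrite !mxE v0 !mul0r !subr0 => /small v1 /small v2.
  by apply: row3E; rewrite !mxE.
split=> //; have := norm1_int R _ v0; move: d1 d2; rewrite !mxE.
set a := (v 0 0)%:~R; set b := (v 0 1)%:~R; set e := (v 0 2)%:~R => d1 d2 a1.
have t0 : 0 <= `|xi| by [].
have t3 : 0 <= `|xi| ^+ 3 by rewrite exprn_ge0.
have b1 : `|b| <= (2 + `|xi| + `|xi| ^+ 3) * `|a|.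
  have -> : b = (b - a * xi) + a * xi by ring.
  by apply: le_trans (ler_normD _ _) _; rewrite normrM; nra.
have e1 : `|e| <= (2 + `|xi| + `|xi| ^+ 3) * `|a|.
  have -> : e = (e - a * xi ^+ 3) + a * xi ^+ 3 by ring.
  by apply: le_trans (ler_normD _ _) _; rewrite normrM normrX; nra.
by rewrite /norm3 !ge_max !mxE b1 e1 !andbT -/a; nra.
Qed.

Section MinimalPoints.
Context {R : realType} {xi : R} {x : nat -> 'rV[int]_3}.
Hypothesis xmin : minimal_points xi x.
Local Notation X i := (norm3 (embZ R (x i))).
Local Notation L i := (Ldist xi (embZ R (x i))).

Lemma minimal_neq0 i : (1 <= i)%N -> x i <> 0.
Proof. by case: xmin => [h _ _ _]; apply: h. Qed.

Lemma minimal_norm_lt i j : (1 <= i)%N -> (i < j)%N -> X i < X j.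
Proof.
case: xmin => [_ h _ _] i1; elim: j => // j IH; rewrite ltnS leq_eqVlt.
case/predU1P => [<-|ij]; first exact: h.
by apply: lt_trans (IH ij) (h _ _); apply: leq_trans (ltnW ij).
Qed.

Lemma minimal_Ldist_lt i j : (1 <= i)%N -> (i < j)%N -> L j < L i.
Proof.
case: xmin => [_ _ [_ h] _] i1; elim: j => // j IH; rewrite ltnS leq_eqVlt.
case/predU1P => [<-|ij]; first exact: h.
by apply: lt_trans (h _ _) (IH ij); apply: leq_trans (ltnW ij).
Qed.

Lemma minimal_Ldist_gt0 i : (1 <= i)%N -> 0 < L i.
Proof.
by move=> i1; apply: le_lt_trans (minimal_Ldist_lt i i.+1 i1 _) => //;
   apply: Ldist_ge0.
Qed.

Lemma minimal_Ldist_lt_half i : (1 <= i)%N -> L i < 2^-1.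
Proof.
have [_ _ [h _] _] := xmin; case: i => [//|[//|i _]].
by apply: lt_trans h; apply: minimal_Ldist_lt.
Qed.

Lemma minimal_norm_ge i : (1 <= i)%N -> i%:R <= X i.
Proof.
move=> i1; have [n Xn] := norm3_embZ_nat R (x i).
rewrite Xn ler_nat; elim: i i1 n Xn => // -[|i] IH _ n Xn.
  rewrite lt0n; apply/eqP => n0.
  have [v0 h] := coord0_bound R xi (x 1%N) (minimal_neq0 1 isT)
    (minimal_Ldist_lt_half 1 isT).
  have [c0 _ _ _ _] := @approx_by_norm3 R xi (embZ R (x 1%N)).
  move: c0; rewrite Xn n0 mxE => /(le_trans (norm1_int R _ v0)).
  by rewrite ler10.
have [m Xm] := norm3_embZ_nat R (x i.+1).
apply: leq_ltn_trans (IH isT m Xm) _.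
by rewrite -(ltr_nat R) -Xm -Xn; apply: minimal_norm_lt.
Qed.

(** Dividing by a common factor would give a point that is both smaller and
    closer to the line. *)
Lemma minimal_primitive i : (1 <= i)%N -> primitive3 (x i).
Proof.
move=> i1.
have [g [x' [g0 xE [u ux]]]] := primitive3_factor _ (minimal_neq0 i i1).
have Li := minimal_Ldist_gt0 i i1.
have LE : L i = `|g|%:~R * Ldist xi (embZ R x').
  by rewrite xE Ldist_embZ_scale.
have XE : X i = `|g|%:~R * norm3 (embZ R x') by rewrite xE norm3_embZ_scale.
have L'0 : 0 < Ldist xi (embZ R x').
  rewrite lt_neqAle Ldist_ge0 andbT eq_sym; apply/eqP => L0.
  by move: Li; rewrite LE L0 mulr0 ltxx.
have x'0 : x' <> 0.
  by move=> x'0; apply: (minimal_neq0 i i1); rewrite xE x'0 scaler0.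
have [g1|g1] := ltP (1 : R) (`|g|%:~R).
  have [_ _ _ minc] := xmin; have := minc i x' i1 x'0.
  have LL : Ldist xi (embZ R x') < L i by rewrite LE; nra.
  move=> /(_ LL) => XX; have := minimal_norm_lt i i.+1 i1 (ltnSn i).
  have := @norm3_ge0 R (embZ R x'); rewrite XE in XX *; nra.
have {g1} gg : g * g = 1.
  move: g1; rewrite -[1]/(1%:~R) ler_int => g1.
  have : `|g| = 1 by apply/le_anti; rewrite g1 -gtz0_ge1 normr_gt0.
  by move=> g1'; rewrite -expr2 -[g ^+ 2]real_normK ?num_real // g1' expr1n.
exists (g *: u); rewrite xE !mxE -[RHS]gg -[RHS]mulr1 -ux; ring.
Qed.

Lemma minimal_indep i j : (1 <= i)%N -> (i < j)%N ->
  exists a b, minor2 (x i) (x j) a b != 0.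
Proof.
move=> i1 ij; apply/not_existsP => no.
have j1 : (1 <= j)%N by apply: leq_trans (ltnW ij).
have [a b|m [x' xE]] :=
  @primitive3_decomp (x i) (x j) 0 (minimal_primitive i i1).
  rewrite dvd0z; apply/eqP/eqP/negPn/negP => ab.
  by apply: (no a); exists b.
move: xE; rewrite scale0r addr0 => xE.
have m0 : m != 0.
  by apply/eqP => m0; apply: (minimal_neq0 j j1); rewrite xE m0 scale0r.
have := minimal_Ldist_lt i j i1 ij.
rewrite xE Ldist_embZ_scale intr_norm ltNge => /negP; apply.
by rewrite ler_peMl ?Ldist_ge0 // norm1_int.
Qed.

(** Between i and the next index of I each three consecutive points are
    dependent, so the plane of the first two contains all the others. *)
Lemma minimal_coplanar i j : (1 <= i)%N -> (i < j)%N ->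
  (forall k, (i < k)%N -> (k < j)%N -> ~ indexI R x k) ->
  det3 (x i) (x i.+1) (x j) = 0.
Proof.
move=> i1 ij noI.
suff : forall k, (i <= k)%N -> (k < j)%N ->
    det3 (x i) (x i.+1) (x k) = 0 /\ det3 (x i) (x i.+1) (x k.+1) = 0.
  by case: j ij {noI} => // j ij /(_ j ij (ltnSn j)) [].
elim=> [|k IH]; first by move=> i0; move: i1; rewrite leqNgt ltnS i0.
rewrite leq_eqVlt => /predU1P[<-|].
  by move=> _; split; rewrite /det3 /minor2; ring.
rewrite ltnS => ik kj; have [ak ak1] := IH ik (ltnW kj); split => //.
have k1 : (1 <= k)%N by apply: leq_trans ik.
have [p [q pq]] := minimal_indep k k.+1 k1 (ltnSn k).
apply: (mulfI pq); rewrite mulr0.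
have dk : det3 (x k) (x k.+1) (x k.+2) = 0.
  have := noI k.+1 ik kj; rewrite /indexI /= ltnS k1 => nI.
  apply/eqP; apply: contraTT isT => dn0; exfalso; apply: nI; split => //.
  by rewrite free3E det3_embZ intr_eq0.
by rewrite plucker_exchange ak ak1 dk; ring.
Qed.

(** No nonzero point of norm at most X_(i+1) / 2 is closer to the line than
    x_i, so the approximation hypothesis at X_(i+1) / 2 bounds L_i. *)
Lemma minimal_decay (lambda mu c : R) : 0 < c -> 0 <= mu -> mu <= lambda ->
  (\forall X \near +oo, exists y : 'rV[int]_3,
     [/\ y <> 0, norm3 (embZ R y) <= X
       & Ldist xi (embZ R y) <= c * X `^ (- lambda)]) ->
  exists (K : R) (N : nat), [/\ 0 <= K, (1 <= N)%N
    & forall i, (N <= i)%N -> ln (L i) <= K - mu * ln (X i.+1)].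
Proof.
move=> c0 mu0 mulam [A [_ HA]].
have ln20 : 0 <= ln 2 :> R by rewrite ln_ge0 // ler1n.
exists (`|ln c| + mu * ln 2), (Num.truncn (2 * `|A| + 2)).+1; split => //.
  by rewrite addr_ge0 ?mulr_ge0.
move=> i Ni; have i1 : (1 <= i)%N by apply: leq_trans Ni.
have Xi : 2 * `|A| + 2 < X i.+1.
  apply: lt_le_trans (minimal_norm_ge i.+1 isT).
  apply: lt_le_trans (truncnS_gt _) _; rewrite ler_nat.
  exact: leq_trans Ni (leqnSn i).
have XA : A < X i.+1 / 2 by have := ler_norm A; lra.
have X1 : 1 < X i.+1 / 2 by have := normr_ge0 A; lra.
have [y [y0 yX yL]] := HA _ XA.
have Ly : L i <= Ldist xi (embZ R y).
  rewrite leNgt; apply/negP => yLi; have [_ _ _ h] := xmin.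
  by have := h i y i1 y0 yLi; lra.
have Lc := le_trans Ly yL.
have L0 := minimal_Ldist_gt0 i i1.
have P0 : 0 < (X i.+1 / 2) `^ (- lambda) by rewrite powR_gt0 //; lra.
have Xp : 0 < X i.+1 by lra.
have lnX : 0 <= ln (X i.+1 / 2) by rewrite ln_ge0 // ltW.
have lnXE : ln (X i.+1 / 2) = ln (X i.+1) - ln 2 by rewrite ln_div ?posrE.
apply: (@le_trans _ _ (ln (c * (X i.+1 / 2) `^ (- lambda)))).
  by rewrite ler_ln ?posrE // mulr_gt0.
rewrite lnM ?posrE // ln_powR.
have : mu * ln (X i.+1 / 2) <= lambda * ln (X i.+1 / 2) by rewrite ler_wpM2r.
have := ler_norm (ln c); rewrite lnXE; lra.
Qed.

Lemma minimal_det (i : nat) : indexI R x i ->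
  0 <= ln 6 + ln (X i.+1) + ln (L i) + ln (L i.-1).
Proof.
case: i => [|[|i]]; do ?by case.
move=> [_]; rewrite free3E det3_embZ intr_eq0 /= => det0.
have lt1 := minimal_norm_lt i.+1 i.+2 isT (ltnSn _).
have lt2 := minimal_norm_lt i.+2 i.+3 isT (ltnSn _).
have Lt1 := minimal_Ldist_lt i.+1 i.+2 isT (ltnSn _).
have Lt2 := minimal_Ldist_lt i.+2 i.+3 isT (ltnSn _).
have L1 := minimal_Ldist_gt0 i.+1 isT.
have L2 := minimal_Ldist_gt0 i.+2 isT.
have X0 := @norm3_ge0 R (embZ R (x i.+2)).
have X3 : 0 < X i.+3 by apply: le_lt_trans lt2.
have := @det3_bound R xi _ _ _ _ _ _ _ _ _ (@norm3_ge0 R _) (ltW lt1) (ltW lt2)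
  (@Ldist_ge0 R xi _) (ltW Lt2) (ltW Lt1) (@approx_by_norm3 R xi _)
  (@approx_by_norm3 R xi _) (@approx_by_norm3 R xi _).
rewrite det3_embZ => /(le_trans (norm1_int R _ det0)) h.
have := ln_ge0 h.
rewrite !lnM ?posrE ?mulr_gt0 //; lra.
Qed.

(** If phi x_i = 0, comparing x_i with x_(i-1) gives
    X_i << (X_i L_(i-1))^3, which fails if L_(i-1) << X_i^(-mu) with
    mu > 2/3. *)
Lemma minimal_phi_neq0 (M : R) (i : nat) : (2 <= i)%N ->
  M = 2 + `|xi| + `|xi| ^+ 3 ->
  ln M + 3 * (ln 2 + ln (X i) + ln (L i.-1)) < ln (X i) -> phi (x i) != 0.
Proof.
case: i => [//|[//|i]] _ ME; rewrite /= => lt.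
apply/eqP => phi0.
have [x0 xM] := coord0_bound R xi (x i.+2) (minimal_neq0 i.+2 isT)
  (minimal_Ldist_lt_half i.+2 isT).
have L1 := minimal_Ldist_gt0 i.+1 isT.
have X1 : 1 <= X i.+2.
  by apply: le_trans (minimal_norm_ge i.+2 isT); rewrite ler1n.
have X0 : 0 < X i.+2 by lra.
have M0 : 0 < M.
  by rewrite ME; have := normr_ge0 xi; have := exprn_ge0 3 (normr_ge0 xi); lra.
have := @phi_eq0_bound R xi (x i.+2) (x i.+1) (minimal_primitive i.+2 isT)
  x0 phi0 (minimal_neq0 i.+1 isT)
  (minimal_norm_lt i.+1 i.+2 isT (ltnSn _))
  (ltW (minimal_Ldist_lt i.+1 i.+2 isT (ltnSn _))).
rewrite -ME in xM; rewrite -(ler_pM2l M0) => /(le_trans xM) h.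
have : ln (X i.+2) <= ln (M * (2 * X i.+2 * L i.+1) ^+ 3).
  by rewrite ler_ln ?posrE ?mulr_gt0 ?exprn_gt0 ?mulr_gt0.
rewrite lnM ?posrE ?exprn_gt0 ?mulr_gt0 // lnXn ?mulr_gt0 //.
rewrite !lnM ?posrE ?mulr_gt0 //; lra.
Qed.

End MinimalPoints.

(** * Divisibility against size *)

(** L is attained by one of x_1 - x_0 xi and x_2 - x_0 xi^3; the matching minor
    is its product with y_0 up to an error of size X N. *)
Lemma minor2_lower (R : realType) (xi M Y N : R) (x y : 'rV[R]_3) :
  let X := norm3 x in let L := Ldist xi x in
  0 < M -> Y <= M * `|y 0 0| -> 2 * M * X <= Y -> N <= L ->
  approx_by xi Y N y ->
  exists k : 'I_3, (k = 1 \/ k = 2) /\ L * Y <= 2 * M * `|minor2 x y 0 k|.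
Proof.
move=> X L M0 YM XY NL [y0 y1 y2 e1 e2].
have [x0 _ _ _ _] := @approx_by_norm3 R xi x.
have L0 : 0 <= L by apply: Ldist_ge0.
have key (t s d : R) : `|t| = L -> `|s| <= N ->
    d = x 0 0 * s - t * y 0 0 -> L * Y <= 2 * M * `|d|.
  move=> tL sN dE.
  have h1 : L * `|y 0 0| <= `|d| + X * L.
    rewrite -tL -normrM.
    have -> : t * y 0 0 = x 0 0 * s - d by rewrite dE; ring.
    apply: (@le_trans _ _ (X * N + `|d|)).
      by apply: normB_le => //; apply: normM_le.
    by rewrite addrC lerD2l tL ler_wpM2l // norm3_ge0.
  have h2 : L * Y <= M * (L * `|y 0 0|).
    have -> : M * (L * `|y 0 0|) = L * (M * `|y 0 0|) by ring.
    by rewrite ler_wpM2l.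
  have h3 : M * (L * `|y 0 0|) <= M * (`|d| + X * L).
    by rewrite ler_wpM2l // ltW.
  have h4 : L * (2 * M * X) <= L * Y by rewrite ler_wpM2l.
  by lra.
have [h|h] := leP `|x 0 2 - x 0 0 * xi ^+ 3| `|x 0 1 - x 0 0 * xi|.
  exists 1; split; first by left.
  apply: (key (x 0 1 - x 0 0 * xi) (y 0 1 - y 0 0 * xi)) => //.
    by rewrite /L /Ldist max_l.
  by rewrite /minor2; ring.
exists 2; split; first by right.
apply: (key (x 0 2 - x 0 0 * xi ^+ 3) (y 0 2 - y 0 0 * xi ^+ 3)) => //.
  by rewrite /L /Ldist max_r // ltW.
by rewrite /minor2; ring.
Qed.

(** The minors of x and z have size X' L and, by coplanarity, n times them are
    nonzero multiples of those of x and y, one of which has size Y L. *)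
Lemma index_lower (R : realType) (xi M X' L' Y N : R) (x y z : 'rV[int]_3)
    (n c : int) :
  let X := norm3 (embZ R x) in let L := Ldist xi (embZ R x) in
  0 < M -> 0 < L -> Y <= M * `|(y 0 0)%:~R| -> 2 * M * X <= Y -> N <= L ->
  X <= X' -> 0 <= L' -> L' <= L ->
  approx_by xi Y N (embZ R y) -> approx_by xi X' L' (embZ R z) -> c != 0 ->
  (forall p q, n * minor2 x z p q = c * minor2 x y p q) ->
  Y <= 4 * M * X' * `|n%:~R|.
Proof.
move=> X L M0 L0 YM XY NL XX L'0 LL ay az c0 nc.
have ax := @approx_by_norm3 R xi (embZ R x).
have YM' : Y <= M * `|embZ R y 0 0| by rewrite mxE.
have [k [k12 low]] := @minor2_lower R xi M Y N (embZ R x) (embZ R y)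
  M0 YM' XY NL ay.
have up := @minor2_upper R xi X L X' L' _ _ k ax az k12.
rewrite -/X -/L in low.
have X0 : 0 <= X by apply: norm3_ge0.
have up' : `|minor2 (embZ R x) (embZ R z) 0 k| <= 2 * (L * X').
  have : X * L' <= X' * L by rewrite ler_pM.
  by lra.
have ncR : `|n%:~R| * `|minor2 (embZ R x) (embZ R z) 0 k|
    = `|c%:~R| * `|minor2 (embZ R x) (embZ R y) 0 k|.
  by rewrite -!normrM !minor2_embZ -!intrM nc.
have c1 := norm1_int R _ c0.
have h1 : `|minor2 (embZ R x) (embZ R y) 0 k| <= `|n%:~R| * (2 * (L * X')).
  apply: le_trans (_ : `|n%:~R| * `|minor2 (embZ R x) (embZ R z) 0 k| <= _).
    by rewrite ncR ler_peMl.
  by rewrite ler_wpM2l.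
rewrite -(ler_pM2l L0); apply: le_trans low _.
have -> : L * (4 * M * X' * `|n%:~R|) = 2 * M * (`|n%:~R| * (2 * (L * X')))
  by ring.
by rewrite ler_wpM2l // mulr_ge0 // ltW.
Qed.

(** The conflict between divisibility and size; x, z, y stand for x_i, x_(i+1)
    and x_j. *)
Lemma sextic_zero_bound (R : realType) (xi M X' L' Y N : R)
    (x y z : 'rV[int]_3) (a b a' b' : 'I_3) :
  let X := norm3 (embZ R x) in let L := Ldist xi (embZ R x) in
  1 <= M -> `|xi| <= M -> 1 <= X -> 0 < L -> L <= 1 ->
  Y <= M * `|(y 0 0)%:~R| -> 2 * M * X <= Y -> 0 <= N -> N <= L ->
  X <= X' -> 0 <= L' -> L' <= L ->
  approx_by xi Y N (embZ R y) -> approx_by xi X' L' (embZ R z) ->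
  primitive3 x -> x 0 0 != 0 -> x 0 2 != 0 -> phi x != 0 -> phi y != 0 ->
  minor2 x y a b != 0 -> minor2 x z a' b' != 0 -> det3 x z y = 0 ->
  512 * M ^+ 3 * (X ^+ 3 * Y * L * N) <= 1 ->
  Fpol x y ^+ 3 + 27 * phi x ^+ 4 * phi y ^+ 2 = 0 ->
  1 <= 2 ^+ 20 * M ^+ 7 * (X * X' ^+ 3 * L ^+ 5).
Proof.
move=> X L M1 xiM X1 L0 L1 YM XY N0 NL XX L'0 LL ay az px x0 x2 S0 V0 xy xz
  det small FSV.
have M0 : 0 < M by lra.
have Y0 : 0 < Y by nra.
have XY' : X <= Y by nra.
have X0 : 0 <= X by lra.
have X'0 : 0 <= 4 * M * X' by nra.
have ax := @approx_by_norm3 R xi (embZ R x); rewrite -/X -/L in ax.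
have [r [r0 Fr r3]] := sextic_zero_param (Fpol x y) (phi x) (phi y) S0 V0 FSV.
have [n [n0 ndvd [u [v [w nE]]]]] := minor2_gcd x y a b xy.
have [c [c0 nc]] := index_cofactor x y z a' b' n u v w det xz n0 nE.
have Yn := index_lower R xi M X' L' Y N x y z n c M0 L0 YM XY NL XX L'0 LL
  ay az c0 nc.
have T0 := not_triple_contact x y a b r x0 x2 S0 xy Fr r3.
have cube := index_cube_dvd x y n r px n0 ndvd Fr r3.
have Fle := @Fpol_bound R xi M X L Y N _ _ M1 xiM X1 XY' N0 NL L1 ax ay.
have Tle := @Phi_bound R xi M X L Y N _ _ M1 xiM X1 XY' N0 NL L1 ax ay.
rewrite Fpol_embZ Fr in Fle; rewrite Phi_embZ in Tle.
have r1 := norm1_int R _ r0.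
have FE : `|(- 3 * r ^+ 2)%:~R : R| = 3 * `|r%:~R| ^+ 2.
  have -> : (- 3 * r ^+ 2)%:~R = - (3 * r%:~R ^+ 2) :> R by ring.
  by rewrite normrN normrM normrX normr_nat.
rewrite FE in Fle.
have YL0 : 0 <= Y * L ^+ 2 by rewrite mulr_ge0 ?exprn_ge0 // ltW.
(* the second term of Fle is at most 1/2 by [small], while r^2 >= 1 *)
have rr : `|r%:~R : R| ^+ 2 <= 7 * (M * (Y * L ^+ 2)) ^+ 2.
  have : 1 <= `|r%:~R : R| ^+ 2 by rewrite exprn_ege1.
  by lra.
have MYL0 : 0 <= M * (Y * L ^+ 2) by rewrite mulr_ge0 // ltW.
have rle : `|r%:~R : R| <= 3 * (M * (Y * L ^+ 2)).
  have B0 : 0 <= 3 * (M * (Y * L ^+ 2)) by rewrite mulr_ge0.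
  rewrite -(@ler_pXn2r _ 2) ?nnegrE //; apply: le_trans rr _.
  by rewrite [leRHS]exprMn; have := sqr_ge0 (M * (Y * L ^+ 2)); lra.
have Q0 : 0 <= X * Y * L by rewrite !mulr_ge0 // ltW.
have YLL : Y * L ^+ 2 <= X * Y * L.
  have -> : Y * L ^+ 2 = L * (Y * L) by ring.
  have -> : X * Y * L = X * (Y * L) by ring.
  by rewrite ler_wpM2r ?(le_trans L1) // mulr_ge0 // ltW.
have Tr : `|(Phi x x y - 3 * r)%:~R : R| <= 21 * M ^+ 2 * (X * Y * L).
  have -> : (Phi x x y - 3 * r)%:~R = (Phi x x y)%:~R - 3 * r%:~R :> R by ring.
  apply: le_trans (normB_le _ _ _ _ _ Tle
    (normM_le _ _ _ _ _ (normn_le R 3) rle)) _.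
  have h1 : M * (Y * L ^+ 2) <= M ^+ 2 * (X * Y * L).
    by rewrite ler_pM ?(ltW M0) // ler_eXnr.
  by lra.
have nT : `|n%:~R : R| ^+ 3
    <= 108 * `|(Phi x x y - 3 * r)%:~R| * `|r%:~R| ^+ 2.
  have P0 : 108 * (Phi x x y - 3 * r) * r ^+ 2 != 0.
    by rewrite !mulf_neq0 ?expf_neq0.
  have /dvdzP[k kE] := cube.
  have k0 : k != 0 by apply: contraNneq P0 => k0; rewrite kE k0 mul0r.
  have -> : 108 * `|(Phi x x y - 3 * r)%:~R| * `|r%:~R| ^+ 2
     = `|(108 * (Phi x x y - 3 * r) * r ^+ 2)%:~R| :> R.
    have -> : (108 * (Phi x x y - 3 * r) * r ^+ 2)%:~R
      = 108 * (Phi x x y - 3 * r)%:~R * r%:~R ^+ 2 :> R by ring.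
    by rewrite normrM normrX normrM normr_nat.
  have -> : `|(108 * (Phi x x y - 3 * r) * r ^+ 2)%:~R : R|
    = `|k%:~R| * `|n%:~R| ^+ 3.
    by rewrite kE -normrX -normrM; congr `| _ |; ring.
  by rewrite ler_peMl ?exprn_ge0 // norm1_int.
have big : `|n%:~R : R| ^+ 3 <= 108 * 147 * M ^+ 4 * X * L ^+ 5 * Y ^+ 3.
  apply: le_trans nT _.
  have -> : 108 * 147 * M ^+ 4 * X * L ^+ 5 * Y ^+ 3
    = 108 * (21 * M ^+ 2 * (X * Y * L)) * (7 * (M * (Y * L ^+ 2)) ^+ 2) by ring.
  by rewrite ler_pM ?mulr_ge0 ?exprn_ge0 // ler_wpM2l.
have YY : Y ^+ 3 <= (4 * M * X') ^+ 3 * `|n%:~R| ^+ 3.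
  by rewrite -exprMn lerXn2r ?nnegrE // ?(ltW Y0) // (le_trans (ltW Y0)).
have Y3 : 0 < Y ^+ 3 by rewrite exprn_gt0.
rewrite -(ler_pM2r Y3) mul1r; apply: le_trans YY _.
apply: (@le_trans _ _ ((4 * M * X') ^+ 3
  * (108 * 147 * M ^+ 4 * X * L ^+ 5 * Y ^+ 3))).
  by rewrite ler_wpM2l ?exprn_ge0.
have -> : (4 * M * X') ^+ 3 * (108 * 147 * M ^+ 4 * X * L ^+ 5 * Y ^+ 3)
  = 2 ^+ 6 * (108 * 147) * (M ^+ 7 * (X * X' ^+ 3 * L ^+ 5) * Y ^+ 3) by ring.
have -> : 2 ^+ 20 * M ^+ 7 * (X * X' ^+ 3 * L ^+ 5) * Y ^+ 3
  = 2 ^+ 6 * 2 ^+ 14 * (M ^+ 7 * (X * X' ^+ 3 * L ^+ 5) * Y ^+ 3) by ring.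
rewrite ler_wpM2r //.
  by rewrite !mulr_ge0 ?exprn_ge0 ?(ltW M0) ?(ltW L0) ?(ltW Y0) //
    (le_trans X0).
by rewrite ler_wpM2l ?exprn_ge0 // -natrM -natrX ler_nat.
Qed.

(** * Comparison of exponents *)

(** A, B, E, G are the logarithms of the norms of x_i, x_(i+1), x_j, x_(j+1),
    and l, p, m, q those of the distances of x_i, x_(i-1), x_j, x_(j-1).  The
    determinant conditions give B >= (30/13) A and G >= (30/13) E up to O(K).
    With mu = 30/43 and k = mu / (1 - mu) = 30/13, the last two conclusions
    need mu k + (mu k - 1) k > 3 and (5 mu - 3) k > 1.  The first holds with a
    margin of about 0.018, which the factor 3600 in front of K accounts for. *)
Lemma exponent_inequalities (R : realType) (A B E G l p m q K : R) :
  0 <= K -> 60 * (60 * K) < A -> B <= E ->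
  l <= K - 30 / 43 * B -> p <= K - 30 / 43 * A ->
  m <= K - 30 / 43 * G -> q <= K - 30 / 43 * E ->
  0 <= K + B + l + p -> 0 <= K + G + m + q ->
  [/\ K + 3 * (K + A + p) < A, K + 3 * (K + E + q) < E, K + A <= B,
      K + 3 * A + E + l + m <= 0 & K + A + 3 * B + 5 * l < 0].
Proof. by move=> *; split; lra. Qed.

Lemma lin_indep_neq0 (R : realType) (xi : R) :
  lin_indep_1_xi_xi3 xi -> xi != 0.
Proof.
move=> indep; apply/eqP => xi0; have [] := indep 0 1 0.
  by rewrite xi0 !rmorph0 rmorph1 !mulr0 mul0r !addr0.
by move=> _ /eqP; rewrite oner_eq0.
Qed.

Lemma pair_size_bounds (R : realType) (K M X X' Y L N : R) :
  1 <= M -> 0 < X -> 0 < X' -> 0 < Y -> 0 < L -> 0 < N ->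
  20 * ln 2 + 7 * ln M <= K ->
  K + ln X <= ln X' -> ln X' <= ln Y ->
  K + 3 * ln X + ln Y + ln L + ln N <= 0 ->
  K + ln X + 3 * ln X' + 5 * ln L < 0 ->
  [/\ 2 * M * X <= Y, 512 * M ^+ 3 * (X ^+ 3 * Y * L * N) <= 1
    & 2 ^+ 20 * M ^+ 7 * (X * X' ^+ 3 * L ^+ 5) < 1].
Proof.
move=> M1 X0 X'0 Y0 L0 N0 KM e1 e2 e3 e4.
have M0 : 0 < M by lra.
have lnM0 : 0 <= ln M by apply: ln_ge0.
have ln2 : 0 <= ln 2 :> R by rewrite ln_ge0 // ler1n.
split.
- rewrite -ler_ln ?posrE ?mulr_gt0 // !lnM ?posrE ?mulr_gt0 //; lra.
- have -> : 512 = 2 ^+ 9 :> R by ring.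
  move: (exprn_gt0 9 (ltr0n R 2)) (lnXn 9 (ltr0n R 2)).
  move: (exprn_gt0 3 M0) (lnXn 3 M0) (exprn_gt0 3 X0) (lnXn 3 X0).
  move: (2 ^+ 9) (M ^+ 3) (X ^+ 3) => t u v u0 lnu v0 lnv t0 lnt.
  rewrite -ler_ln ?posrE ?mulr_gt0 // ln1.
  by rewrite !lnM ?posrE ?mulr_gt0 // lnu lnv lnt; lra.
- move: (exprn_gt0 20 (ltr0n R 2)) (lnXn 20 (ltr0n R 2)).
  move: (exprn_gt0 7 M0) (lnXn 7 M0) (exprn_gt0 3 X'0) (lnXn 3 X'0).
  move: (exprn_gt0 5 L0) (lnXn 5 L0).
  move: (2 ^+ 20) (M ^+ 7) (X' ^+ 3) (L ^+ 5).
  move=> t u v w w0 lnw u0 lnu v0 lnv t0 lnt.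
  rewrite -ltr_ln ?posrE ?mulr_gt0 // ln1.
  by rewrite !lnM ?posrE ?mulr_gt0 // lnu lnv lnw lnt; lra.
Qed.

Theorem theorem6p3 (R : realType) (xi lambda c : R) (x : nat -> 'rV[int]_3) :
  lin_indep_1_xi_xi3 xi ->
  0 < lambda ->
  0 < c ->
  (\forall X \near +oo, exists y : 'rV[int]_3,
     [/\ y <> 0, norm3 (embZ R y) <= X
       & Ldist xi (embZ R y) <= c * X `^ (- lambda)]) ->
  minimal_points xi x ->
  6985 / 10000 <= lambda ->
  \forall i \near \oo, forall j : nat, succI R x i j ->
    Fpol (x i) (x j) ^+ 3 + 27 * phi (x i) ^+ 4 * phi (x j) ^+ 2 <> 0.
Proof.
move=> /lin_indep_neq0 xi0 _ c0 approximable xmin lam.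
have {}lam : 30 / 43 <= lambda.
  by apply: le_trans lam; clear; lra.
have mu0 : 0 <= 30 / 43 :> R by lra.
have [K0 [N [K00 N1 decay]]] := minimal_decay xmin lambda _ c c0 mu0 lam
  approximable.
pose M := 2 + `|xi| + `|xi| ^+ 3.
have xi3 : 0 < `|xi| ^+ 3 by rewrite exprn_gt0 // normr_gt0.
have M1 : 1 <= M by rewrite /M; have := normr_ge0 xi; lra.
have M0 : 0 < M by lra.
have xiM : `|xi| <= M by rewrite /M; lra.
have lnM0 : 0 <= ln M by apply: ln_ge0.
have ln2 : 0 <= ln 2 :> R by rewrite ln_ge0 // ler1n.
have ln6 : ln 6 <= 3 * ln 2 :> R.
  have -> : 3 * ln 2 = ln (2 ^+ 3) :> R by rewrite lnXn // mulr_natl.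
  by rewrite ler_ln ?posrE ?exprn_gt0 // -natrX ler_nat.
(* one constant dominating the logarithms of all implied constants *)
pose K := K0 + 20 * ln 2 + 7 * ln M.
have K_ge0 : 0 <= K by rewrite /K; lra.
have KK0 : K0 <= K by rewrite /K; lra.
have Kfinal : 20 * ln 2 + 7 * ln M <= K by rewrite /K; lra.
have det_le (a b d : R) : 0 <= ln 6 + a + b + d -> 0 <= K + a + b + d.
  by rewrite /K; lra.
have phi_le (a p : R) : K + 3 * (K + a + p) < a ->
    ln M + 3 * (ln 2 + a + p) < a.
  by rewrite /K; lra.
clearbody K.
pose N' := maxn N.+1 (Num.truncn (expR (60 * (60 * K)) + M / `|xi| ^+ 3)).+1.
exists N' => // i /= Ni j [Ii Ij ij between].
have i2 : (2 <= i)%N by case: Ii.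
have i1 : (1 <= i)%N by apply: ltnW.
have j2 : (2 <= j)%N by case: Ij.
have j1 : (1 <= j)%N by apply: ltnW.
have iN : (N <= i.-1)%N.
  by rewrite -ltnS (ltn_predK i2); apply: leq_trans Ni; rewrite leq_maxl.
have Nj : (N <= j.-1)%N.
  by apply: leq_trans iN _; rewrite -!subn1 leq_sub2r // ltnW.
have Xbig : expR (60 * (60 * K)) + M / `|xi| ^+ 3 < norm3 (embZ R (x i)).
  apply: lt_le_trans (minimal_norm_ge xmin i i1).
  apply: lt_le_trans (truncnS_gt _) _; rewrite ler_nat.
  by apply: leq_trans Ni; rewrite leq_maxr.
have di := decay i (leq_trans iN (leq_pred i)).
have di' := decay i.-1 iN; rewrite (ltn_predK i2) in di'.
have dj := decay j (leq_trans Nj (leq_pred j)).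
have dj' := decay j.-1 Nj; rewrite (ltn_predK j2) in dj'.
have deti := minimal_det xmin i Ii.
have detj := minimal_det xmin j Ij.
have Xi' := minimal_norm_lt xmin i i.+1 i1 (ltnSn i).
have Xij := minimal_norm_lt xmin i j i1 ij.
have Xi'j : norm3 (embZ R (x i.+1)) <= norm3 (embZ R (x j)).
  move: ij; rewrite leq_eqVlt => /predU1P[<-//|ij].
  by apply/ltW/(minimal_norm_lt xmin i.+1 j).
have Lij := minimal_Ldist_lt xmin i j i1 ij.
have Li' := minimal_Ldist_lt xmin i i.+1 i1 (ltnSn i).
have Li := minimal_Ldist_gt0 xmin i i1.
have Lj := minimal_Ldist_gt0 xmin j j1.
have Li2 := minimal_Ldist_lt_half xmin i i1.
have det0 := minimal_coplanar xmin i j i1 ij between.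
have [a [b xy]] := minimal_indep xmin i j i1 ij.
have [a' [b' xz]] := minimal_indep xmin i i.+1 i1 (ltnSn i).
have [x0 XM] := coord0_bound R xi (x i) (minimal_neq0 xmin i i1) Li2.
have [_ YM] := coord0_bound R xi (x j) (minimal_neq0 xmin j j1)
  (minimal_Ldist_lt_half xmin j j1).
rewrite -/M in XM YM.
have ax := @approx_by_norm3 R xi (embZ R (x i)).
have ay := @approx_by_norm3 R xi (embZ R (x j)).
have az := @approx_by_norm3 R xi (embZ R (x i.+1)).
have Li'0 := @Ldist_ge0 R xi (embZ R (x i.+1)).
have X1 : 1 <= norm3 (embZ R (x i)).
  by apply: le_trans (minimal_norm_ge xmin i i1); rewrite ler1n.
have px := minimal_primitive xmin i i1.
(* otherwise x_i0 xi^3 would be small, although |x_i0| >> X_i *)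
have x2 : x i 0 2 != 0.
  apply/eqP => x20; have [_ _ _ _] := ax.
  rewrite !mxE x20 sub0r normrN normrM normrX => xL.
  have h : M < norm3 (embZ R (x i)) * `|xi| ^+ 3.
    rewrite -ltr_pdivrMr //; apply: le_lt_trans Xbig.
    by rewrite lerDr expR_ge0.
  have h2 : norm3 (embZ R (x i)) * `|xi| ^+ 3
      <= M * (`|(x i 0 0)%:~R| * `|xi| ^+ 3).
    by rewrite mulrA ler_wpM2r // ltW.
  have h3 : `|(x i 0 0)%:~R| * `|xi| ^+ 3 < 1.
    apply: le_lt_trans xL (lt_le_trans Li2 _).
    by rewrite invf_le1 // ler1n.
  have := lt_le_trans h h2.
  by rewrite -[ltLHS]mulr1 ltr_pM2l // ltNge (ltW h3).
have A_big : 60 * (60 * K) < ln (norm3 (embZ R (x i))).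
  rewrite -[60 * (60 * K)]expRK ltr_ln ?posrE ?expR_gt0 //;
    last exact: lt_le_trans X1.
  apply: le_lt_trans Xbig; rewrite lerDl divr_ge0 ?(ltW M0) ?(ltW xi3) //.
have BE : ln (norm3 (embZ R (x i.+1))) <= ln (norm3 (embZ R (x j))).
  have X0 := lt_le_trans ltr01 X1.
  by rewrite ler_ln ?posrE // ?(lt_trans X0 Xi') ?(lt_trans X0 Xij).
have [e1 e2 e3 e4 e5] := exponent_inequalities _ _ _ _ _ _ _ _ _ K K_ge0 A_big
  BE (le_trans di (lerB KK0 (lexx _))) (le_trans di' (lerB KK0 (lexx _)))
  (le_trans dj (lerB KK0 (lexx _))) (le_trans dj' (lerB KK0 (lexx _)))
  (det_le _ _ _ deti) (det_le _ _ _ detj).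
have X0 : 0 < norm3 (embZ R (x i)) by apply: lt_le_trans X1.
have [s1 s2 s3] := pair_size_bounds _ _ _ _ _ _ _ _ M1 X0 (lt_trans X0 Xi')
  (lt_trans X0 Xij) Li Lj Kfinal e3 BE e4 e5.
have S0 := minimal_phi_neq0 xmin M i i2 erefl (phi_le _ _ e1).
have V0 := minimal_phi_neq0 xmin M j j2 erefl (phi_le _ _ e2).
have L1 : Ldist xi (embZ R (x i)) <= 1.
  by apply: le_trans (ltW Li2) _; rewrite invf_le1 // ler1n.
move=> FSV; move: s3; rewrite ltNge => /negP; apply.
exact: (@sextic_zero_bound R xi M _ _ _ _ (x i) (x j) (x i.+1) a b a' b'
  M1 xiM X1 Li L1 YM s1 (ltW Lj) (ltW Lij) (ltW Xi') Li'0 (ltW Li') ay az px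
  x0 x2 S0 V0 xy xz det0 s2 FSV).
Qed.
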